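(* Let $V_{5}$ and $V_{6}$ be the varieties of bands defined (within the variety of bands) by the identities $zxy\approx zxzy$ and $yxz\approx yzxz$, respectively. Then $V_5$ and $V_6$ are mutually derived by $\sigma_{4}$, i.e. $(V_{5})_{\sigma_{4}}=V_{6}$ and $(V_{6})_{\sigma_{4}}=V_{5}$. Moreover, $\dim(V_{5})=\dim(V_{6})=3$.
   Context: A band is an idempotent semigroup, viewed as an algebra of type $(2)$ (one binary operation, written as juxtaposition). A hypersubstitution of type $(2)$ is a choice $\sigma$ of a binary term $\sigma(xy)$ in the variables $x,y$; $\sigma_4$ denotes the hypersubstitution with $\sigma_{4}(xy)=yx$. For an algebra $\mathbf{A}=(A,\cdot)$ of type $(2)$ the derived algebra $\mathbf{A}_{\sigma}$ is the set $A$ with the binary term operation induced by $\sigma(xy)$ on $\mathbf{A}$. For a variety $V$ of type $(2)$, the derived variety $V_{\sigma}$ is the variety (of type $(2)$) generated by $\{\mathbf{A}_{\sigma}:\mathbf{A}\in V\}$; it is proper if $V_{\sigma}\neq V$. The dimension $\dim(V)$ is the cardinality of the set of all proper derived varieties $V_{\sigma}$ of $V$ that are included in $V$, where $\sigma$ ranges over all hypersubstitutions of type $(2)$. *)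

(* Defs.v *)
From mathcomp Require Import all_boot.
From mathcomp Require Import boolp classical_sets functions cardinality.

Set Implicit Arguments.
Unset Strict Implicit.
Unset Printing Implicit Defensive.

Local Open Scope classical_set_scope.
Local Open Scope card_scope.

(* As usual in universal algebra, carriers are nonempty. *)
Record algebra := Algebra {
  carrier :> Type;
  op : carrier -> carrier -> carrier;
  carrier_inhabited : inhabited carrier
}.

Inductive term (X : Type) := Var of X | App of term X & term X.

Fixpoint eval (X : Type) (A : algebra) (env : X -> A) (t : term X) : A :=
  match t with
  | Var v => env v
  | App s t => op (eval env s) (eval env t)
  end.

Definition identity := (term nat * term nat)%type.

Definition satisfies (A : algebra) (e : identity) :=
  forall env : nat -> A, eval env e.1 = eval env e.2.

Definition Mod (Sigma : set identity) : set algebra :=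
  [set A | forall e, Sigma e -> satisfies A e].

Definition is_variety (V : set algebra) := exists Sigma, V = Mod Sigma.

Definition generated_variety (K : set algebra) : set algebra :=
  \bigcap_(V in [set V | is_variety V /\ K `<=` V]) V.

Inductive var2 := vx | vy.

(* A hypersubstitution of type (2) is determined by the term sigma(xy). *)
Definition hypersubstitution := term var2.

Definition derived_algebra (sigma : hypersubstitution) (A : algebra) : algebra :=
  Algebra (fun a b : A => eval (fun v => if v is vx then a else b) sigma)
          (carrier_inhabited A).

Definition derived_variety (sigma : hypersubstitution) (V : set algebra) :
    set algebra :=
  generated_variety (derived_algebra sigma @` V).

Definition proper_derived_subvarieties (V : set algebra) : set (set algebra) :=
  [set W | (exists sigma, W = derived_variety sigma V) /\ W <> V /\ W `<=` V].

Definition has_dim (V : set algebra) (n : nat) : Prop :=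
  proper_derived_subvarieties V #= `I_n.

Definition sigma4 : hypersubstitution := App (Var vy) (Var vx).

Local Notation "s ∙ t" := (App s t) (at level 40, left associativity).
Local Notation x := (Var 0).
Local Notation y := (Var 1).
Local Notation z := (Var 2).

Definition band_identities : set identity :=
  [set (x ∙ y ∙ z, x ∙ (y ∙ z)); (x ∙ x, x)].

(* Products such as zxy are bracketed to the left; associativity makes the
   choice immaterial. *)
Definition V5 : set algebra :=
  Mod (band_identities `|` [set (z ∙ x ∙ y, z ∙ x ∙ z ∙ y)]).

Definition V6 : set algebra :=
  Mod (band_identities `|` [set (y ∙ x ∙ z, y ∙ z ∙ x ∙ z)]).

(* Main.v *)
(** A binary term evaluates in every band like one of the six words x, y, xy,
    yx, xyx, yxy. Over V5 the first four yield the left zero bands, the right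
    zero bands, V5 and V6, and xyx yields the left regular bands, because
    a * b := aba satisfies a * b * a = a * b and equals ab in a left regular
    band. The left zero band on two elements with an adjoined identity lies in
    V5 while its dual does not; this excludes yx and yxy. Reversing words
    transfers everything to V6. *)

Require Import Defs.
From mathcomp Require Import all_boot.
From mathcomp Require Import boolp classical_sets functions cardinality.

Set Implicit Arguments.
Unset Strict Implicit.
Unset Printing Implicit Defensive.

Local Open Scope classical_set_scope.
Local Open Scope card_scope.

Local Notation "s ∙ t" := (App s t) (at level 40, left associativity).
Local Notation dual := (derived_algebra sigma4).

(** * Generated and derived varieties *)

Lemma generated_variety_sub (K V : set algebra) :
  is_variety V -> K `<=` V -> generated_variety K `<=` V.
Proof. by move=> vV KV A; apply. Qed.

Lemma sub_generated_variety (K : set algebra) : K `<=` generated_variety K.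
Proof. by move=> A KA V [_]; apply. Qed.

Lemma generated_variety_id (V : set algebra) :
  is_variety V -> generated_variety V = V.
Proof.
move=> vV; apply/seteqP; split; last exact: sub_generated_variety.
exact: generated_variety_sub.
Qed.

(** Since [sigma] fixes every algebra of [W], each member of [W] is itself one of the generators; no
    closure under products, subalgebras or quotients has to be analysed. *)
Lemma derived_variety_eq sigma (V W : set algebra) :
  is_variety W ->
  (forall A, V A -> W (derived_algebra sigma A)) ->
  (forall A, W A -> V A /\ derived_algebra sigma A = A) ->
  derived_variety sigma V = W.
Proof.
move=> vW VW WV; apply/seteqP; split.
  by apply: generated_variety_sub => // _ [A VA <-]; exact: VW.
move=> A WA; have [VA eA] := WV A WA.
by apply: sub_generated_variety; exists A.
Qed.

Lemma derived_algebra_eq sigma tau (A : algebra) :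
  (forall env : var2 -> A, eval env sigma = eval env tau) ->
  derived_algebra sigma A = derived_algebra tau A.
Proof.
move=> h; rewrite /derived_algebra.
by under eq_fun do under eq_fun do rewrite h.
Qed.

Lemma derived_algebra_id sigma (A : algebra) :
  (forall a b : A, @op (derived_algebra sigma A) a b = op a b) ->
  derived_algebra sigma A = A.
Proof.
case: A => T m i h; rewrite /derived_algebra.
by congr Algebra; apply/funext => a; apply/funext => b; exact: h.
Qed.

Lemma eq_derived_variety sigma tau (V : set algebra) :
  (forall A, V A -> derived_algebra sigma A = derived_algebra tau A) ->
  derived_variety sigma V = derived_variety tau V.
Proof.
move=> h; congr generated_variety; apply/seteqP.
by split=> _ [A VA <-]; exists A => //; rewrite h.
Qed.

(** * Duality *)

Lemma dualK (A : algebra) : dual (dual A) = A.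
Proof. by case: A. Qed.

Lemma dual_preimageK : involutive (preimage dual : set algebra -> set algebra).
Proof. by move=> V; apply/seteqP; split=> A; rewrite /preimage /= dualK. Qed.

(** An involution has equal image and preimage. The preimage form is preferred because membership in
    it computes. *)
Lemma dual_image (K : set algebra) : dual @` K = dual @^-1` K.
Proof.
apply/seteqP; split=> [_ [A KA <-]|A KA]; first by rewrite /preimage /= dualK.
by exists (dual A) => //; exact: dualK.
Qed.

Fixpoint mirror (X : Type) (t : term X) : term X :=
  if t is s ∙ u then mirror u ∙ mirror s else t.

Lemma eval_dual (X : Type) (A : algebra) (env : X -> A) t :
  @eval X (dual A) env t = eval env (mirror t).
Proof. by elim: t => //= s -> u ->. Qed.

(** The mirrored identities axiomatize the dual class. *)
Lemma dual_variety (V : set algebra) : is_variety V -> is_variety (dual @^-1` V).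
Proof.
move=> [Sigma ->]; exists ((fun e => (mirror e.1, mirror e.2)) @` Sigma).
apply/seteqP; split=> A hA.
  by move=> _ [e Se <-] env /=; rewrite -!eval_dual; exact: hA.
move=> e Se env; rewrite !eval_dual.
by apply: (hA (mirror e.1, mirror e.2)); exists e.
Qed.

Lemma generated_variety_dual (K : set algebra) :
  generated_variety (dual @^-1` K) = dual @^-1` generated_variety K.
Proof.
have sub L : dual @^-1` generated_variety L `<=` generated_variety (dual @^-1` L).
  move=> A hA V [vV LV]; rewrite -(dualK A).
  apply: (hA (dual @^-1` V)); split; first exact: dual_variety.
  by move=> B LB; apply: LV; rewrite /preimage /= dualK.
apply/seteqP; split; last exact: sub.
(* The converse inclusion is [sub] for the dual class, pulled back along [dual]. *)
rewrite -[X in X `<=` _]dual_preimageK -{2}[K]dual_preimageK.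
by move=> A; exact: sub.
Qed.

Definition swap (v : var2) := if v is vx then vy else vx.

(** This is conjugation by [sigma4]: dualizing the algebra before deriving mirrors the word, and
    dualizing the result exchanges the two arguments. *)
Fixpoint conjugate (t : term var2) : term var2 :=
  match t with
  | Var v => Var (swap v)
  | s ∙ u => conjugate u ∙ conjugate s
  end.

Lemma conjugateK : involutive conjugate.
Proof. by elim=> [[]|s /= -> u ->]. Qed.

Lemma derived_algebra_dual sigma (A : algebra) :
  derived_algebra sigma (dual A) = dual (derived_algebra (conjugate sigma) A).
Proof.
rewrite /derived_algebra; congr Algebra; apply/funext => a; apply/funext => b /=.
by elim: sigma => [[]|s /= -> u ->].
Qed.

Lemma derived_variety_dual sigma (V : set algebra) :
  derived_variety sigma (dual @^-1` V) =
  dual @^-1` derived_variety (conjugate sigma) V.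
Proof.
rewrite -generated_variety_dual; congr generated_variety.
rewrite -!dual_image !image_comp; congr image; apply/funext => A /=.
exact: derived_algebra_dual.
Qed.

(** Conjugation permutes the hypersubstitutions, while [preimage dual] is injective and preserves
    inclusion in both directions. *)
Lemma proper_derived_subvarieties_dual (V : set algebra) :
  proper_derived_subvarieties (dual @^-1` V) =
  preimage dual @` proper_derived_subvarieties V.
Proof.
apply/seteqP; split.
  move=> _ [[sigma ->]]; rewrite derived_variety_dual => -[neq sub].
  exists (derived_variety (conjugate sigma) V) => //.
  split; first by exists (conjugate sigma).
  split; first by move=> eqV; apply: neq; rewrite eqV.
  by move=> A WA; rewrite -(dualK A); apply: sub; rewrite /preimage /= dualK.
move=> _ [_ [[sigma ->] [neq sub]] <-]; split.
  by exists (conjugate sigma); rewrite derived_variety_dual conjugateK.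
split; last by move=> A; exact: sub.
by move=> /(congr1 (preimage dual)); rewrite !dual_preimageK.
Qed.

Lemma has_dim_dual (V : set algebra) n : has_dim V n -> has_dim (dual @^-1` V) n.
Proof.
rewrite /has_dim proper_derived_subvarieties_dual; apply: card_eq_trans.
by apply: inj_card_eq => U W _ _; exact: (inv_inj dual_preimageK).
Qed.

(** * Bands and their binary terms *)

Definition is_band (A : algebra) : Prop :=
  associative (@op A) /\ idempotent_op (@op A).

Lemma Mod_setU (S T : set identity) : Mod (S `|` T) = Mod S `&` Mod T.
Proof.
apply/seteqP; split=> A.
  by move=> h; split=> e he; apply: h; [left|right].
by move=> [hS hT] e [/hS|/hT].
Qed.

Lemma Mod1 e (A : algebra) : Mod [set e] A <-> satisfies A e.
Proof. by split=> [|h _ ->//]; apply. Qed.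

Definition env3 (A : algebra) (a b c : A) (n : nat) : A :=
  match n with 0 => a | 1 => b | _ => c end.

Lemma Mod_band A : Mod band_identities A <-> is_band A.
Proof.
rewrite /band_identities Mod_setU; split=> [[/Mod1 hA /Mod1 hI]|[hA hI]].
  split=> [a b c|a]; first exact: (esym (hA (env3 a b c))).
  exact: (hI (env3 a a a)).
by split; apply/Mod1 => env /=; rewrite ?hA ?hI.
Qed.

Lemma V5P A :
  V5 A <-> is_band A /\
    forall a b c : A, op (op a b) c = op (op (op a b) a) c.
Proof.
rewrite /V5 Mod_setU; split=> [[/Mod_band bA /Mod1 h]|[bA h]].
  (* The identity starts with z, so [a] is the value of variable 2. *)
  by split=> // a b c; exact: (h (env3 b c a)).
by split; [exact/Mod_band|apply/Mod1 => env; exact: h].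
Qed.

Lemma V6P A :
  V6 A <-> is_band A /\
    forall a b c : A, op (op a b) c = op (op (op a c) b) c.
Proof.
rewrite /V6 Mod_setU; split=> [[/Mod_band bA /Mod1 h]|[bA h]].
  by split=> // a b c; exact: (h (env3 b a c)).
by split; [exact/Mod_band|apply/Mod1 => env; exact: h].
Qed.

(** Read backwards, zxy = zxzy becomes yxz = yzxz. *)
Lemma V6_dual : V6 = dual @^-1` V5.
Proof.
apply/seteqP; split=> A.
  move/V6P=> [[hA hI] h]; apply/V5P; split; first split=> // a b c /=.
    by rewrite hA.
  by move=> a b c /=; rewrite !hA h.
move/V5P=> [[hA hI] /= h]; apply/V6P; split; first split=> // a b c /=.
  exact: (esym (hA c b a)).
move=> a b c; have hA' (u v w : A) : op (op u v) w = op u (op v w) by exact: (hA w v u).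
by rewrite !hA' h.
Qed.

(** These words represent the elements of the free band on two generators. *)
Inductive band_word : term var2 -> Prop :=
| word_x : band_word (Var vx)
| word_y : band_word (Var vy)
| word_xy : band_word (Var vx ∙ Var vy)
| word_yx : band_word (Var vy ∙ Var vx)
| word_xyx : band_word (Var vx ∙ Var vy ∙ Var vx)
| word_yxy : band_word (Var vy ∙ Var vx ∙ Var vy).

Lemma band_word_exists sigma : exists2 w, band_word w &
  forall A, is_band A -> forall env : var2 -> A, eval env sigma = eval env w.
Proof.
suff closed s t : band_word s -> band_word t -> exists2 w, band_word w &
    forall A, is_band A -> forall env : var2 -> A, eval env (s ∙ t) = eval env w.
  elim: sigma => [v|s [s' ws es] t [t' wt et]].
    by exists (Var v) => //; case: v; constructor.
  have [w ww ew] := closed _ _ ws wt; exists w => // A bA env.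
  by rewrite -ew //= es // et.
(* In left-bracketed words each of the squares aa and abab needs two rules: one at the start of the
   word and one after a prefix c. *)
have red A : is_band A ->
    ((forall a : A, op a a = a) *
     (forall a c : A, op (op c a) a = op c a) *
     (forall a b : A, op (op (op a b) a) b = op a b) *
     (forall a b c : A, op (op (op (op c a) b) a) b = op (op c a) b))%type.
  move=> [hA hI]; split; [split; [split|]|] => [a|a c|a b|a b c] //.
  - by rewrite -hA hI.
  - by rewrite -hA hI.
  - by rewrite -(hA _ a b) -!(hA c) hI.
(* Each of the 36 products is settled by search: the six words are tried in turn, and a wrong
   candidate fails after normalization. *)
case=> [] [];
  by ((exists (Var vx) + exists (Var vy) + exists (Var vx ∙ Var vy) +
       exists (Var vy ∙ Var vx) + exists (Var vx ∙ Var vy ∙ Var vx) +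
       exists (Var vy ∙ Var vx ∙ Var vy));
      [constructor|
       move=> A bA env /=; have [hA _] := bA; rewrite ?hA ?(red _ bA)]).
Qed.

Lemma derived_variety_band_word (V : set algebra) sigma :
  (forall A, V A -> is_band A) ->
  exists2 w, band_word w & derived_variety sigma V = derived_variety w V.
Proof.
move=> Vb; have [w ww ew] := band_word_exists sigma; exists w => //.
apply: eq_derived_variety => A /Vb bA; apply: derived_algebra_eq => env.
exact: ew.
Qed.

(** * Left zero, right zero and left regular bands *)

Definition left_zero_bands := Mod [set (Var 0 ∙ Var 1, Var 0)].

Definition right_zero_bands := Mod [set (Var 0 ∙ Var 1, Var 1)].

Definition left_regular_bands :=
  Mod (band_identities `|` [set (Var 0 ∙ Var 1 ∙ Var 0, Var 0 ∙ Var 1)]).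

Lemma is_variety_Mod Sigma : is_variety (Mod Sigma).
Proof. by exists Sigma. Qed.

Lemma left_zero_bandsP A :
  left_zero_bands A <-> forall a b : A, op a b = a.
Proof.
split=> [/Mod1 h a b|h]; first exact: (h (env3 a b b)).
by apply/Mod1 => env; exact: h.
Qed.

Lemma right_zero_bandsP A :
  right_zero_bands A <-> forall a b : A, op a b = b.
Proof.
split=> [/Mod1 h a b|h]; first exact: (h (env3 a b b)).
by apply/Mod1 => env; exact: h.
Qed.

Lemma left_regular_bandsP A :
  left_regular_bands A <-> is_band A /\
    forall a b : A, op (op a b) a = op a b.
Proof.
rewrite /left_regular_bands Mod_setU.
split=> [[/Mod_band bA /Mod1 h]|[bA h]].
  by split=> // a b; exact: (h (env3 a b b)).
by split; [exact/Mod_band|apply/Mod1 => env; exact: h].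
Qed.

(** Every product collapses to its first factor, so xy = x alone entails associativity, idempotence
    and the identity of [V5]. *)
Lemma left_zero_bands_sub : left_zero_bands `<=` V5.
Proof.
move=> A /left_zero_bandsP h; apply/V5P.
by split; [split=> [a b c|a]|move=> a b c]; rewrite ?h.
Qed.

Lemma right_zero_bands_sub : right_zero_bands `<=` V5.
Proof.
move=> A /right_zero_bandsP h; apply/V5P.
by split; [split=> [a b c|a]|move=> a b c]; rewrite ?h.
Qed.

(** Multiplying aba = ab by c on the right gives abac = abc. *)
Lemma left_regular_bands_sub : left_regular_bands `<=` V5.
Proof.
move=> A /left_regular_bandsP[bA h]; apply/V5P; split=> // a b c.
by rewrite h.
Qed.

(** * Varieties derived from [V5] *)

Lemma derived_V5_x : derived_variety (Var vx) V5 = left_zero_bands.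
Proof.
apply: derived_variety_eq => [|A _|A lA]; first exact: is_variety_Mod.
  exact/left_zero_bandsP.
split; first exact: left_zero_bands_sub.
by apply: derived_algebra_id => a b; move/left_zero_bandsP: lA => ->.
Qed.

Lemma derived_V5_y : derived_variety (Var vy) V5 = right_zero_bands.
Proof.
apply: derived_variety_eq => [|A _|A rA]; first exact: is_variety_Mod.
  exact/right_zero_bandsP.
split; first exact: right_zero_bands_sub.
by apply: derived_algebra_id => a b; move/right_zero_bandsP: rA => ->.
Qed.

Lemma derived_V5_xy : derived_variety (Var vx ∙ Var vy) V5 = V5.
Proof.
have id A : derived_algebra (Var vx ∙ Var vy) A = A by exact: derived_algebra_id.
by apply: derived_variety_eq => [|A|A]; [exact: is_variety_Mod|rewrite id|].
Qed.

Lemma derived_V5_xyx :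
  derived_variety (Var vx ∙ Var vy ∙ Var vx) V5 = left_regular_bands.
Proof.
apply: derived_variety_eq => [|A /V5P[[hA hI] h]|A lA].
- exact: is_variety_Mod.
- apply/left_regular_bandsP; split; first split=> [a b c|a] /=.
  (* Associativity of a * b := aba amounts to abcba = abacaba. Two uses of the identity insert the
     missing letters a: abc.ba = abc.a.ba, and then abc = abac. *)
  + by have := h a (@op A b c) (@op A b a); rewrite !hA -(h a b c) => ->.
  + by rewrite !hI.
  + by move=> a b /=; rewrite -(hA _ a a) !hI.
- split; first exact: left_regular_bands_sub.
  by apply: derived_algebra_id => a b /=; move/left_regular_bandsP: lA => [_ ->].
Qed.

(** * Separating algebras *)

Definition left_zero_with_identity (a b : option bool) : option bool :=
  if a is Some _ then a else b.

Definition left_zero_monoid : algebra :=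
  Algebra left_zero_with_identity (inhabits None).

Lemma left_zero_monoid_left_regular : left_regular_bands left_zero_monoid.
Proof.
apply/left_regular_bandsP; split; first split.
- by move=> [a|] [b|] [c|].
- by move=> [a|].
- by move=> [a|] [b|].
Qed.

(** In the dual the last factor other than the identity survives. With c the identity, abc is b
    whereas abac is a. *)
Lemma dual_left_zero_monoid : ~ V5 (dual left_zero_monoid).
Proof. by move/V5P => [_ /(_ (Some true) (Some false) None)]. Qed.

Lemma derived_V5_yx_not_sub : ~ derived_variety (Var vy ∙ Var vx) V5 `<=` V5.
Proof.
move=> /(_ (dual left_zero_monoid)) h; apply: dual_left_zero_monoid.
apply: h; apply: sub_generated_variety; exists left_zero_monoid => //.
exact/left_regular_bands_sub/left_zero_monoid_left_regular.
Qed.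

Lemma derived_V5_yxy_not_sub :
  ~ derived_variety (Var vy ∙ Var vx ∙ Var vy) V5 `<=` V5.
Proof.
move=> /(_ (dual left_zero_monoid)) h; apply: dual_left_zero_monoid.
apply: h; apply: sub_generated_variety; exists left_zero_monoid.
  exact/left_regular_bands_sub/left_zero_monoid_left_regular.
(* The monoid is left regular, so yxy = yx there and the derived algebra is again its dual. *)
rewrite /derived_algebra; congr Algebra.
by apply/funext => -[a|]; apply/funext => -[b|].
Qed.

Definition left_zero_two : algebra :=
  Algebra (fun a b : bool => a) (inhabits true).

Lemma left_zero_bands_two : left_zero_bands left_zero_two.
Proof. exact/left_zero_bandsP. Qed.

Lemma right_zero_bands_two : right_zero_bands (dual left_zero_two).
Proof. exact/right_zero_bandsP. Qed.

Lemma left_zero_neq_right_zero : left_zero_bands <> right_zero_bands.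
Proof.
move=> e; have := left_zero_bands_two; rewrite e.
by move/right_zero_bandsP/(_ true false).
Qed.

Lemma left_zero_neq_left_regular : left_zero_bands <> left_regular_bands.
Proof.
move=> e; have := left_zero_monoid_left_regular; rewrite -e.
by move/left_zero_bandsP/(_ None (Some true)).
Qed.

(** In a right zero band aba = a but ab = b. This separates the left regular bands both from the
    right zero bands and from [V5], which contains the latter. *)
Lemma right_zero_not_left_regular : ~ right_zero_bands `<=` left_regular_bands.
Proof.
move=> /(_ _ right_zero_bands_two)/left_regular_bandsP[_].
by move/(_ true false).
Qed.

(** * Dimension *)

Lemma proper_derived_subvarieties_V5 :
  proper_derived_subvarieties V5 =
  [set left_zero_bands; right_zero_bands; left_regular_bands].
Proof.
have bV5 A : V5 A -> is_band A by move/V5P => [].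
apply/seteqP; split=> W.
  move=> [[sigma ->] []]; have [w + ->] := derived_variety_band_word sigma bV5.
  case.
  - by rewrite derived_V5_x; left; left.
  - by rewrite derived_V5_y; left; right.
  (* The word xy returns [V5] itself, which is not proper. *)
  - by rewrite derived_V5_xy.
  - by move=> _ /derived_V5_yx_not_sub.
  - by rewrite derived_V5_xyx; right.
  - by move=> _ /derived_V5_yxy_not_sub.
move=> [[->|->]|->]; split.
- by exists (Var vx); rewrite derived_V5_x.
- split; last exact: left_zero_bands_sub.
  move=> e; have := right_zero_bands_sub right_zero_bands_two.
  by rewrite -e => /left_zero_bandsP/(_ true false).
- by exists (Var vy); rewrite derived_V5_y.
- split; last exact: right_zero_bands_sub.
  move=> e; have := left_zero_bands_sub left_zero_bands_two.
  by rewrite -e => /right_zero_bandsP/(_ true false).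
- by exists (Var vx ∙ Var vy ∙ Var vx); rewrite derived_V5_xyx.
- split; last exact: left_regular_bands_sub.
  move=> e; apply: right_zero_not_left_regular; rewrite e.
  exact: right_zero_bands_sub.
Qed.

Lemma card_set3 (T : Type) (a b c : T) :
  a <> b -> a <> c -> b <> c -> [set a; b; c] #= `I_3.
Proof.
(* The value [c] beyond 2 is only a default: [f] is restricted to [I_3], where it is injective. *)
move=> ab ac bc; pose f n := if n is n'.+1 then if n' is 0 then b else c else a.
have -> : [set a; b; c] = f @` `I_3.
  apply/seteqP; split=> [t [[->|->]|->]|t [[|[|[|//]]] _ <-]] /=; try tauto.
  - by exists 0.
  - by exists 1.
  - by exists 2.
have [ba ca cb] : [/\ b <> a, c <> a & c <> b] by split; exact: nesym.
by apply: inj_card_eq => -[|[|[|i]]] [|[|[|j]]]; rewrite !inE.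
Qed.

Lemma has_dim_V5 : has_dim V5 3.
Proof.
rewrite /has_dim proper_derived_subvarieties_V5; apply: card_set3.
- exact: left_zero_neq_right_zero.
- exact: left_zero_neq_left_regular.
- by move=> e; apply: right_zero_not_left_regular; rewrite e.
Qed.

Theorem theorem4p6 :
  derived_variety sigma4 V5 = V6 /\ derived_variety sigma4 V6 = V5 /\
  has_dim V5 3 /\ has_dim V6 3.
Proof.
split; last split; last split.
(* The derived algebras of [V5] already form the variety [V6], so generating adds nothing. *)
- rewrite /derived_variety dual_image -V6_dual.
  exact/generated_variety_id/is_variety_Mod.
- rewrite /derived_variety dual_image V6_dual dual_preimageK.
  exact/generated_variety_id/is_variety_Mod.
- exact: has_dim_V5.
- by rewrite V6_dual; exact/has_dim_dual/has_dim_V5.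
Qed.
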